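(* Let $\mathbf{x}\in\mathbb{R}^n$, let $\mathbf{w}=(w_1,\ldots,w_m)\in\mathbb{R}^m$ with $w_i>0$ for all $i$, and let $G_1,\ldots,G_m$ be nonempty subsets of $\{1,2,\ldots,n\}$ (which may overlap arbitrarily). For $j=1,\ldots,n$ set $$l_j=\sum_{i=1}^{m}\frac{w_i}{\sqrt{|G_i|}}\,\mathbb{I}(j\in G_i),$$ and let $\mathbf{L}=\operatorname{diag}(l_1,\ldots,l_n)$. Then $$\|\mathbf{L}\mathbf{x}\|_1\le \sum_{i=1}^{m}w_i\|\mathbf{x}_{G_i}\|_2,$$ and equality holds if and only if for every $G_i$, $i=1,\ldots,m$, the entries of $\mathbf{x}_{G_i}$ are identical.
   Context: For a subset $G\subseteq\{1,\ldots,n\}$ and $\mathbf{x}\in\mathbb{R}^n$, $\mathbf{x}_G\in\mathbb{R}^{|G|}$ denotes the subvector of $\mathbf{x}$ with entries $x_j$, $j\in G$, so $\|\mathbf{x}_G\|_2=\sqrt{\sum_{j\in G}x_j^2}$; $|G|$ is the number of elements of $G$. $\mathbb{I}(e)=1$ if $e$ is true and $0$ otherwise. $\|\cdot\|_1$ and $\|\cdot\|_2$ are the $\ell_1$ and Euclidean norms.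
   Formalization: The equality condition is that the entries of each x_{G_i} are identical in absolute value; with plainly identical entries the ''only if'' fails, e.g. n=2, m=1, G_1={1,2}, w_1=1, x=(1,-1), where both sides equal √2. *)

(* Defs.v *)
From mathcomp Require Import all_boot all_order all_algebra.
From mathcomp Require Import reals.

Set Implicit Arguments.
Unset Strict Implicit.
Unset Printing Implicit Defensive.

Import Order.TTheory GRing.Theory Num.Theory.
Local Open Scope ring_scope.

Definition norm1 (R : realType) (p : nat) (v : 'cV[R]_p) : R :=
  \sum_(k < p) `|v k 0|.

Definition norm2 (R : realType) (p : nat) (v : 'cV[R]_p) : R :=
  Num.sqrt (\sum_(k < p) v k 0 ^+ 2).

Definition subvec (R : realType) (n : nat) (x : 'cV[R]_n) (G : {set 'I_n}) :
    'cV[R]_#|G| :=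
  rowsub enum_val x.

Definition group_weight (R : realType) (n m : nat) (w : 'cV[R]_m)
    (G : 'I_m -> {set 'I_n}) (j : 'I_n) : R :=
  \sum_(i < m) w i 0 / Num.sqrt #|G i|%:R * (j \in G i)%:R.

Definition group_weight_mx (R : realType) (n m : nat) (w : 'cV[R]_m)
    (G : 'I_m -> {set 'I_n}) : 'M[R]_n :=
  diag_mx (\row_j group_weight w G j).

(* Entries are compared up to sign: for v = (1, -1) one has
   norm1 v = sqrt 2 * norm2 v although the two entries differ, so plain
   equality of the entries does not characterize the equality case. *)
Definition identical_abs_entries (R : realType) (p : nat) (v : 'cV[R]_p) : Prop :=
  forall k l : 'I_p, `|v k 0| = `|v l 0|.

(* Main.v *)
Require Import Defs.
From mathcomp Require Import all_boot all_order all_algebra.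
From mathcomp Require Import reals.

(** Exchanging the order of summation turns the left-hand side into
    [\sum_i w_i / sqrt #|G_i| * norm1 x_{G_i}], so both sides are combinations
    of one term per group and the comparison can be made group by group. For a
    single vector [v] of dimension [p], it is the Cauchy-Schwarz inequality
    [norm1 v <= sqrt p * norm2 v] between the vector of the [`|v_k|] and the
    all-ones vector. Lagrange's identity (lemma [lagrange_ones]) expresses the
    difference of the squares of the two sides through the squares
    [(`|v_k| - `|v_l|) ^+ 2], which yields the inequality and the equality case
    at once (lemma [norm1_leif_norm2]). As all [w_i] are positive, the sum over the
    groups is an equality exactly when it is one for each group. The
    [leif] relation ([_ <= _ ?= iff _]) carries both halves of the claim
    through each of these steps. *)

Set Implicit Arguments.
Unset Strict Implicit.
Unset Printing Implicit Defensive.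

Import Order.TTheory GRing.Theory Num.Theory.
Local Open Scope ring_scope.

(** Lagrange's identity for [a] and the all-ones vector: the bracket on the
    right is the defect in the squared Cauchy-Schwarz inequality, doubled
    because each unordered pair of indices occurs in both orders. *)
Lemma lagrange_ones (R : comPzRingType) (p : nat) (a : 'I_p -> R) :
  \sum_k \sum_l (a k - a l) ^+ 2
    = (p%:R * (\sum_k a k ^+ 2) - (\sum_k a k) ^+ 2) *+ 2.
Proof.
under eq_bigr => k _ do
  (under eq_bigr do rewrite sqrrB; rewrite big_split sumrB /= sumr_const card_ord
     sumrMnl -mulr_sumr).
rewrite big_split sumrB /= sumr_const card_ord !sumrMnl -mulr_suml.
by rewrite expr2 mulr_natl mulrnBl mulr2n addrAC.
Qed.

(** Both sides are nonnegative, so they compare as their squares do; the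
    difference of the squares is half the sum in [lagrange_ones] for the
    absolute values of the entries, and a sum of squares vanishes only if each
    of them does. *)
Lemma norm1_leif_norm2 (R : realType) (p : nat) (v : 'cV[R]_p) :
  norm1 v <= Num.sqrt p%:R * norm2 v
    ?= iff [forall k, forall l, `|v k 0| == `|v l 0|].
Proof.
have norm1_ge0 : 0 <= norm1 v by exact: sumr_ge0.
have rhs_ge0 : 0 <= Num.sqrt p%:R * norm2 v by rewrite mulr_ge0 ?sqrtr_ge0.
rewrite -(mono_in_leif (ler_pXn2r (ltn0Sn 1))) ?nnegrE //.
rewrite exprMn !sqr_sqrtr ?sumr_ge0 // => [|k _]; last exact: sqr_ge0.
under [X in _ * X]eq_bigr do rewrite -real_normK ?num_real //.
have: 0 <= \sum_k \sum_l (`|v k 0| - `|v l 0|) ^+ 2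
    ?= iff [forall k, forall l, `|v k 0| == `|v l 0|].
  apply: leif_0_sum => k _; apply: leif_0_sum => l _; split; first exact: sqr_ge0.
  by rewrite eq_sym sqrf_eq0 subr_eq0.
rewrite lagrange_ones => -[defect_ge0 defect_eq0]; split.
  by rewrite -subr_ge0 -(pmulrn_lge0 _ (ltn0Sn 1)).
by rewrite -defect_eq0 [RHS]eq_sym mulrn_eq0 subr_eq0 eq_sym.
Qed.

(** The diagonal entries are nonnegative, so they come out of the absolute
    values unchanged; the double sum over pairs [j \in G i] can then be
    collected by groups. *)
Lemma norm1_group_weight_mx (R : realType) (n m : nat) (x : 'cV[R]_n)
    (w : 'cV[R]_m) (G : 'I_m -> {set 'I_n}) :
  (forall i, 0 <= w i 0) ->
  norm1 (group_weight_mx w G *m x)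
    = \sum_(i < m) w i 0 / Num.sqrt #|G i|%:R * norm1 (subvec x (G i)).
Proof.
move=> w_ge0; rewrite /norm1.
have weight_ge0 j : 0 <= group_weight w G j.
  by apply: sumr_ge0 => i _; rewrite !mulr_ge0 ?invr_ge0 ?sqrtr_ge0.
under eq_bigr => j _ do
  rewrite mul_diag_mx !mxE normrM ger0_norm // mulr_suml.
rewrite exchange_big; apply: eq_bigr => i _ /=.
under eq_bigr do rewrite -[_ * `|_|]mulrA.
rewrite -mulr_sumr; congr (_ * _).
under [RHS]eq_bigr do rewrite mxE.
rewrite -(big_enum_val (fun j => `|x j 0|)) [RHS]big_mkcond.
by apply: eq_bigr => j _; case: (j \in G i); rewrite ?mul1r ?mul0r.
Qed.

Theorem lemma1p2 (R : realType) (n m : nat) (x : 'cV[R]_n) (w : 'cV[R]_m)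
    (G : 'I_m -> {set 'I_n})
    (w_gt0 : forall i : 'I_m, 0 < w i 0)
    (G_neq0 : forall i : 'I_m, G i != set0) :
  norm1 (group_weight_mx w G *m x)
    <= \sum_(i < m) w i 0 * norm2 (subvec x (G i)) /\
  (norm1 (group_weight_mx w G *m x)
     = \sum_(i < m) w i 0 * norm2 (subvec x (G i)) <->
   forall i : 'I_m, identical_abs_entries (subvec x (G i))).
Proof.
have leif_group i : w i 0 / Num.sqrt #|G i|%:R * norm1 (subvec x (G i))
    <= w i 0 * norm2 (subvec x (G i))
    ?= iff [forall k, forall l, `|subvec x (G i) k 0| == `|subvec x (G i) l 0|].
  have sqrt_gt0 : 0 < Num.sqrt #|G i|%:R :> R.
    by rewrite sqrtr_gt0 ltr0n card_gt0.
  have coef_gt0 : 0 < w i 0 / Num.sqrt #|G i|%:R by rewrite divr_gt0.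
  have -> : w i 0 * norm2 (subvec x (G i)) = w i 0 / Num.sqrt #|G i|%:R
      * (Num.sqrt #|G i|%:R * norm2 (subvec x (G i))).
    by rewrite mulrA divfK ?gt_eqF.
  by rewrite (mono_leif (ler_pM2l coef_gt0)); exact: norm1_leif_norm2.
rewrite norm1_group_weight_mx => [|i]; last exact: ltW.
have [le_sum eq_sum] := leif_sum (fun i (_ : true) => leif_group i).
split=> //; split=> [/eqP | same_abs].
  rewrite eq_sum => /forallP same_abs i k l.
  by apply/eqP; have /forallP/(_ k)/forallP := same_abs i; exact.
apply/eqP; rewrite eq_sum; apply/forallP => i /=.
by apply/forallP => k; apply/forallP => l; apply/eqP; exact: same_abs.
Qed.
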